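(* Let $(N,M,V,G)$ be a problem instance with $|N|>\Delta(G)$, and let $A=\langle A_i\rangle_{i\in N}$ be the random feasible allocation produced by the following procedure: (1) let $\pi$ be a permutation of $M$ selected uniformly at random; (2) tentatively allocate each item to an agent selected uniformly at random (independently for the different items and of $\pi$); (3) for each pair of conflicting items $j,j'$ that were tentatively allocated to the same agent, with $\pi_j<\pi_{j'}$, deallocate $j'$ (conflicts being determined by the tentative allocation of step (2), before any deallocation); (4) allocate the remaining items arbitrarily, avoiding conflicts. Then each agent expects to get at least a fraction $1-1/e$ of its proportional share, i.e., for every $i\in N$, $\mathbb{E}[v_i(A_i)]\ge\left(1-\frac{1}{e}\right)\frac{v_i(M)}{|N|}$.
   Context: A problem instance is a quadruple $(N,M,V,G)$, where $N$ is a finite set of $n$ agents, $M$ is a finite set of $m$ items, $V$ is a family of additive valuation functions $v_i:2^M\to\mathbb{R}_{\ge 0}$, $i\in N$, and $G=(M,E)$ is an undirected (simple) conflict graph on the items. Two items are conflicting if they are adjacent in $G$. An allocation is an ordered partition $A=\langle A_i\rangle_{i\in N}$ of all of $M$ into $|N|$ (possibly empty) bundles; it is feasible if every bundle is an independent set of $G$. Agent $i$'s proportional share is $v_i(M)/|N|$. $\Delta(G)$ is the maximum degree of $G$. *)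

(* Defs.v *)
From HB Require Import structures.
From mathcomp Require Import all_boot all_order all_algebra perm.
From mathcomp Require Import all_classical all_reals all_analysis.

Set Implicit Arguments.
Unset Strict Implicit.
Unset Printing Implicit Defensive.

Import Order.TTheory GRing.Theory Num.Theory.

Local Open Scope classical_set_scope.
Local Open Scope ring_scope.

Definition additive_valuation (R : realType) (M : finType)
    (v : {set M} -> R) : Prop :=
  (forall S : {set M}, 0 <= v S) /\
  (forall S : {set M}, v S = \sum_(j in S) v [set j]%SET).

Definition simple_graph (M : finType) (adj : rel M) : Prop :=
  symmetric adj /\ irreflexive adj.

Definition max_degree (M : finType) (adj : rel M) : nat :=
  \max_(j : M) #|adj j|.

Definition independent (M : finType) (adj : rel M) (S : {set M}) : bool :=
  [forall j in S, forall k in S, ~~ adj j k].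

Definition is_allocation (N M : finType) (A : {ffun N -> {set M}}) : Prop :=
  (\bigcup_(i : N) A i)%SET = [set: M]%SET /\
  (forall i i' : N, i != i' -> A i :&: A i' = finset.set0)%SET.

Definition feasible (N M : finType) (adj : rel M)
    (A : {ffun N -> {set M}}) : Prop :=
  is_allocation A /\ (forall i : N, independent adj (A i)).

(* pi_j < pi_k, where items are compared through the fixed enumeration
   enum_rank : M -> 'I_#|M| (the informal M = {1, ..., m}). *)
Definition precedes (M : finType) (pi : {perm M}) (j k : M) : bool :=
  (enum_rank (pi j) < enum_rank (pi k))%N.

Definition deallocated (N M : finType) (adj : rel M) (pi : {perm M})
    (t : {ffun M -> N}) (k : M) : bool :=
  [exists j : M, [&& adj j k, t j == t k & precedes pi j k]].

(* A is a possible final result of the procedure when pi is the permutation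
   and t the tentative allocation: any feasible allocation in which the items
   that were not deallocated stay where t put them. *)
Definition completes (N M : finType) (adj : rel M) (pi : {perm M})
    (t : {ffun M -> N}) (A : {ffun N -> {set M}}) : Prop :=
  feasible adj A /\
  (forall j : M, ~~ deallocated adj pi t j -> j \in A (t j)).

Section RandomProcedure.
Context {d : measure_display} {T : measurableType d} {R : realType}.
Variable P : probability T R.

Definition finite_rv (F : finType) (X : T -> F) : Prop :=
  forall x : F, measurable [set w | X w = x].

Definition uniform_rv (F : finType) (X : T -> F) : Prop :=
  finite_rv X /\
  (forall x : F, P [set w | X w = x] = (#|F|%:R^-1)%:E).

(* Mutual independence of pi and of all the coordinates t_j. The product rule
   for the joint law of the whole family gives it for every subfamily, by
   summing over the values of the remaining variables. *)
Definition mutually_independent (N M : finType) (pi : T -> {perm M})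
    (t : T -> {ffun M -> N}) : Prop :=
  forall (p : {perm M}) (s : {ffun M -> N}),
    P [set w | pi w = p /\ (forall j : M, t w j = s j)] =
    (P [set w | pi w = p] * \prod_(j : M) P [set w | t w j = s j])%E.

(* The arbitrary choices of the last step may depend on the whole outcome w,
   so they may be randomized and correlated with pi and t. *)
Definition produced_by_procedure (N M : finType) (adj : rel M)
    (pi : T -> {perm M}) (t : T -> {ffun M -> N})
    (A : T -> {ffun N -> {set M}}) : Prop :=
  [/\ uniform_rv pi,
      forall j : M, uniform_rv (fun w => t w j),
      mutually_independent pi t,
      finite_rv A &
      forall w : T, completes adj (pi w) (t w) (A w)].

End RandomProcedure.

(* Main.v *)
Require Import Defs.
From HB Require Import structures.
From mathcomp Require Import all_boot all_order all_algebra perm.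
From mathcomp Require Import all_classical all_reals all_analysis.
From mathcomp Require Import measurable_realfun.

Import Order.TTheory GRing.Theory Num.Theory.
Local Open Scope ring_scope.

(* Item j stays with agent i as soon as t_j = i and no neighbour of j preceding
   j is tentatively given to i. With n agents and D neighbours this has
   probability (1/n) E[q^B], where q = 1 - 1/n and B is the number of neighbours
   preceding j. By symmetry j is equally likely to have each rank in its closed
   neighbourhood, so E[q^B] is the mean of q^0, ..., q^D. As D + 1 <= n and the
   powers decrease, this is at least the mean of q^0, ..., q^(n-1), which is
   1 - q^n >= 1 - 1/e. Linearity of expectation concludes. *)

(** An injective [x] ranks [S], so each exponent from 0 to [#|S| - 1] occurs once. The induction
    removes the member with the largest [x]: it carries the top power and is counted in no other
    exponent. *)
Lemma sum_expr_count (R : pzSemiRingType) (M : finType) (x : M -> nat) (q : R)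
    (S : {set M}) : injective x ->
  \sum_(k in S) q ^+ #|[set l in S | x l < x k]%N| = \sum_(r < #|S|) q ^+ r.
Proof.
move=> x_inj; move: {2}#|S| (erefl #|S|) => n.
elim: n S => [|n IHn] S cardS.
  move/eqP: cardS; rewrite cards_eq0 => /eqP ->.
  by rewrite cards0 big_set0 big_ord0.
have [k0 k0S] : exists k, k \in S by apply/set0Pn; rewrite -card_gt0 cardS.
have [m mS maxm] : exists2 m, m \in S & {in S, forall l, x l <= x m}%N.
  by case: (arg_maxnP x k0S) => m mS maxm; exists m.
have cardSm : #|S :\ m| = n by move: (cardsD1 m S); rewrite mS cardS => -[].
have lt_max l : l \in S -> l != m -> (x l < x m)%N.
  by move=> lS lm; rewrite ltn_neqAle (inj_eq x_inj) lm; exact: maxm.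
rewrite (big_setD1 m) //= cardS big_ord_recr /= addrC; congr (_ + _ ^+ _).
  have := IHn _ cardSm; rewrite cardSm => <-; apply: eq_bigr => k /setD1P[km kS].
  congr (_ ^+ #|pred_of_set _|); apply/setP => l; rewrite !inE.
  have [->|//] := eqVneq l m.
  by rewrite mS /= ltnNge ltnW // lt_max.
rewrite -cardSm; apply: eq_card => l; rewrite !inE.
have [->|lm] := eqVneq l m; first by rewrite ltnn andbF.
by case lS: (l \in S) => //=; rewrite lt_max.
Qed.

(** Each power added after the first [a] is at most every one of those, so it cannot raise the mean.
    Denominators are cleared, which also covers [a = 0]. *)
Lemma geometric_mean_decreasing (R : numDomainType) (q : R) (a b : nat) :
  0 <= q <= 1 -> (a <= b)%N ->
  a%:R * \sum_(r < b) q ^+ r <= b%:R * \sum_(r < a) q ^+ r.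
Proof.
move=> /andP[q0 q1] /subnK <-; elim: (b - a)%N => [|k IHk]; first exact: lexx.
rewrite addSn big_ord_recr /= mulrDr -natr1 mulrDl lerD // mul1r.
rewrite mulr_natl -[X in _ *+ X]card_ord -sumr_const ler_sum // => r _.
by rewrite ler_wiXn2l // ltnW // ltn_addl.
Qed.

Lemma expr_onem_le_expR (R : realType) (n : nat) : (0 < n)%N ->
  (1 - n%:R^-1) ^+ n <= (expR 1)^-1 :> R.
Proof.
move=> n0; have nR : n%:R != 0 :> R by rewrite pnatr_eq0 -lt0n.
have -> : (expR 1)^-1 = expR (- n%:R^-1) ^+ n :> R.
  by rewrite -expRM_natl mulrN mulfV // expRN.
(* Raise [1 + x <= expR x] at [x = - n%:R^-1] to the power [n]; this needs [1 - n%:R^-1] to be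
   nonnegative. *)
rewrite lerXn2r ?nnegrE ?expR_ge0 //; last exact: expR_ge1Dx.
by rewrite subr_ge0 invf_le1 ?ltr0n // ler1n.
Qed.

Lemma precedes_inj_rank (M : finType) (p : {perm M}) :
  injective (fun k => nat_of_ord (enum_rank (p k))).
Proof. by move=> k l /val_inj /enum_rank_inj /perm_inj. Qed.

(* Precomposing with the transposition of [j] and [k] shows that every member
   of [S] has the same distribution of the number of members preceding it. *)
Lemma sum_expr_preceding (R : comNzRingType) (M : finType) (q : R) (S : {set M})
    (j : M) : j \in S ->
  #|S|%:R * \sum_(p : {perm M}) q ^+ #|[set l in S | precedes p l j]| =
  #|{perm M}|%:R * \sum_(r < #|S|) q ^+ r.
Proof.
move=> jS.
have sumE k : k \in S ->
    \sum_(p : {perm M}) q ^+ #|[set l in S | precedes p l j]| =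
    \sum_(p : {perm M}) q ^+ #|[set l in S | precedes p l k]|.
  move=> kS; rewrite (reindex_inj (mulgI (tperm j k))) /=.
  apply: eq_bigr => p _; congr (_ ^+ _).
  rewrite -(card_preimset _ (@perm_inj _ (tperm j k))).
  apply: eq_card => l; rewrite !inE /precedes !permM tpermK tpermL.
  by congr (_ && _); case: tpermP => // ->; rewrite jS kS.
transitivity (\sum_(p : {perm M}) \sum_(r < #|S|) q ^+ r); last first.
  by rewrite sumr_const mulr_natl.
(* The factor [#|S|] becomes a sum over [k] in [S], the copy for [k] using [k] in place of [j]. For
   each fixed [p] the inner sum then meets every rank once. *)
rewrite mulr_natl -sumr_const (eq_bigr _ sumE) exchange_big /=.
apply: eq_bigr => p _; exact: sum_expr_count (@precedes_inj_rank _ p).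
Qed.

Lemma retention_bound (R : realType) (M : finType) (n : nat) (S : {set M})
    (j : M) : j \in S -> (#|S| <= n)%N ->
  1 - (expR 1)^-1 <=
  #|{perm M}|%:R^-1 * \sum_(p : {perm M})
     (1 - n%:R^-1) ^+ #|[set l in S | precedes p l j]| :> R.
Proof.
move=> jS Sn; set q := 1 - n%:R^-1.
have S0 : (0 < #|S|)%N by rewrite card_gt0; apply/set0Pn; exists j.
have n0 : (0 < n)%N := leq_trans S0 Sn.
have SR : 0 < #|S|%:R :> R by rewrite ltr0n.
have nR : 0 < n%:R :> R by rewrite ltr0n.
have permR : 0 < #|{perm M}|%:R :> R.
  by rewrite ltr0n; apply/card_gt0P; exists 1%g.
have q01 : 0 <= q <= 1.
  by rewrite /q subr_ge0 gerBl invr_ge0 (ltW nR) andbT invf_le1 // ler1n.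
(* This is the geometric sum with [1 - q] equal to [n%:R^-1]. *)
have geo_n : \sum_(r < n) q ^+ r = n%:R * (1 - q ^+ n).
  rewrite -[1 - q ^+ n]opprB subrX1 -mulNr opprB /q subKr mulrA mulfV ?mul1r //.
  exact: lt0r_neq0.
rewrite -(ler_pM2l SR) mulrCA sum_expr_preceding // mulKf ?lt0r_neq0 //.
rewrite -(ler_pM2l nR).
apply: le_trans (geometric_mean_decreasing _ _ _ _ q01 Sn).
by rewrite geo_n mulrCA !ler_pM2l // lerD2l lerN2 expr_onem_le_expR.
Qed.

(** The constraints bear on separate coordinates, so the sum factors: [#|N|%:R^-1] at [j],
    [1 - #|N|%:R^-1] at each item of [B], and 1 elsewhere. *)
Lemma sum_avoiding (R : numFieldType) (N M : finType) (i : N) (j : M)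
    (B : {set M}) : j \notin B ->
  \sum_(s : {ffun M -> N} | (s j == i) && [forall k in B, s k != i])
     \prod_(k : M) #|N|%:R^-1 = #|N|%:R^-1 * (1 - #|N|%:R^-1) ^+ #|B| :> R.
Proof.
move=> jB; set c := #|N|%:R^-1.
have NR : #|N|%:R != 0 :> R by rewrite pnatr_eq0 -lt0n; apply/card_gt0P; exists i.
pose allowed k a := if k == j then a == i else (k \in B) ==> (a != i).
(* Forbidden values get weight 0, so the sum ranges over all functions and distributivity turns it
   into a product of sums. *)
transitivity (\sum_(s : {ffun M -> N}) \prod_(k : M)
    (if allowed k (s k) then c else 0)).
  rewrite big_mkcond; apply: eq_bigr => s _.
  case: ifPn => [/andP[sj /forall_inP sB]|].
    apply: eq_bigr => k _; rewrite /allowed.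
    case: eqP => [->|_]; first by rewrite sj.
    by case kB: (k \in B) => //=; rewrite sB.
  rewrite negb_and => /orP[sj|/forall_inPn[k kB /negPn sk]].
    by rewrite (bigD1 j) //= /allowed eqxx (negPf sj) mul0r.
  have /negPf kj : k != j by apply: contraNneq jB => <-.
  by rewrite (bigD1 k) //= /allowed kj kB /= sk mul0r.
rewrite -(bigA_distr_bigA (fun k a => if allowed k a then c else 0)) (bigD1 j) //=.
rewrite -big_mkcond /= (eq_bigl (pred1 i)); last by move=> a; rewrite /allowed eqxx.
rewrite big_pred1_eq; congr (_ * _).
have -> : (1 - c) ^+ #|B| = \prod_(k in B) (1 - c) by rewrite prodr_const.
have -> : \prod_(k in B) (1 - c) = \prod_(k | (k != j) && (k \in B)) (1 - c).
  by apply: eq_bigl => k; case: eqVneq => [->|//]; rewrite (negPf jB).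
rewrite [RHS]big_mkcondr; apply: eq_bigr => k kj; rewrite -big_mkcond /=.
have sumc : \sum_(a : N) c = 1 by rewrite sumr_const -[c *+ _]mulr_natl mulfV.
case: ifP => kB; last first.
  by rewrite -[RHS]sumc; apply: eq_bigl => a; rewrite /allowed (negPf kj) kB.
transitivity (\sum_(a : N | a != i) c).
  by apply: eq_bigl => a; rewrite /allowed (negPf kj) kB.
by rewrite -[in RHS]sumc [X in _ = X - _](bigD1 i) //= [RHS]addrC addKr.
Qed.

(** * Random variables with finitely many values *)

Section FiniteRandomVariables.
Context {d : measure_display} {T : measurableType d} {R : realType}.
Variable P : probability T R.
Local Open Scope classical_set_scope.

Lemma finite_rv_event (F : finType) (X : T -> F) (E : {pred F}) :
  [set w | X w \in E] = \bigcup_(x in [set` E]) [set w | X w = x].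
Proof.
apply/seteqP; split => w /=; first by exists (X w).
by move=> [x xE] /= ->.
Qed.

Lemma measurable_finite_rv (F : finType) (X : T -> F) (E : {pred F}) :
  finite_rv X -> measurable [set w | X w \in E].
Proof.
move=> mX; rewrite finite_rv_event.
by apply: fin_bigcup_measurable => // x _; exact: mX.
Qed.

Lemma probability_finite_rv (F : finType) (X : T -> F) (E : {pred F}) :
  finite_rv X ->
  P [set w | X w \in E] = (\sum_(x in E) P [set w | X w = x])%E.
Proof.
move=> mX; rewrite finite_rv_event measure_fin_bigcup //; last first.
  by move=> x y _ _ [w [/= <- <-]].
have -> : [set` E] = [set` enum E].
  by apply/seteqP; split => x /=; rewrite mem_enum.
by rewrite -fsbig_seq ?enum_uniq // big_enum.
Qed.

(** Treating the pair as one uniform finite variable reduces every event about [pi] and [t] to a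
    finite weighted count. *)
Lemma joint_law (N M : finType) (pi : T -> {perm M}) (t : T -> {ffun M -> N}) :
  uniform_rv P pi -> (forall j, uniform_rv P (fun w => t w j)) ->
  mutually_independent P pi t ->
  finite_rv (fun w => (pi w, t w)) /\
  forall p s, P [set w | (pi w, t w) = (p, s)] =
    (#|{perm M}|%:R^-1 * \prod_(j : M) #|N|%:R^-1)%:E.
Proof.
move=> [mpi Ppi] ut ind.
have setE p s : [set w | (pi w, t w) = (p, s)] =
    [set w | pi w = p /\ forall j, t w j = s j].
  by apply/seteqP; split => w /= [-> ts]; [rewrite ts|congr pair; apply/ffunP].
split=> [[p s]|p s]; rewrite setE.
  rewrite [X in measurable X](_ : _ = [set w | pi w = p] `&`
      \bigcap_(j in [set: M]) [set w | t w j = s j]); last first.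
    apply/seteqP; split => w /=; first by move=> [-> ts]; split => // j _ /=.
    by move=> [-> ts]; split => // j; exact: (ts j I).
  apply: measurableI; first exact: mpi.
  by apply: fin_bigcap_measurable => // j _; exact: (ut j).1.
rewrite ind Ppi EFinM -prodEFin; congr (_ * _)%E.
by apply: eq_bigr => j _; exact: (ut j).2.
Qed.

Lemma retention_probability (N M : finType) (adj : rel M) (pi : T -> {perm M})
    (t : T -> {ffun M -> N}) (i : N) (j : M) :
  simple_graph adj ->
  uniform_rv P pi -> (forall k, uniform_rv P (fun w => t w k)) ->
  mutually_independent P pi t ->
  P [set w | (t w j == i) && ~~ deallocated adj (pi w) (t w) j] =
  (#|N|%:R^-1 * (#|{perm M}|%:R^-1 * \sum_(p : {perm M})
     (1 - #|N|%:R^-1) ^+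
       #|[set l in j |: [set k | adj j k] | precedes p l j]%SET|))%:E.
Proof.
move=> [adj_sym _] upi ut ind; have [mX PX] := joint_law _ _ _ _ upi ut ind.
pose E : {pred {perm M} * {ffun M -> N}} :=
  fun x => (x.2 j == i) && ~~ deallocated adj x.1 x.2 j.
rewrite -[X in P X]/[set w | (pi w, t w) \in E] probability_finite_rv //.
rewrite (eq_bigr (fun=> (#|{perm M}|%:R^-1 * \prod_(k : M) #|N|%:R^-1)%:E)); last first.
  by move=> -[p s] _; exact: PX.
rewrite sumEFin. congr (_%:E).
rewrite -(pair_big_dep xpredT (fun (p : {perm M}) (s : {ffun M -> N}) =>
    (s j == i) && ~~ deallocated adj p s j)
  (fun _ _ => #|{perm M}|%:R^-1 * \prod_(j : M) #|N|%:R^-1)) /=.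
rewrite mulrCA !mulr_sumr; apply: eq_bigr => p _; rewrite -mulr_sumr; congr (_ * _).
have jB : j \notin [set l in j |: [set k | adj j k] | precedes p l j]%SET.
  by rewrite inE /precedes ltnn andbF.
(* Once [s j] is [i], surviving means that no earlier neighbour gets [i]. Taking the closed
   neighbourhood changes nothing here, as [j] does not precede itself. *)
rewrite -(sum_avoiding R _ _ i _ _ jB); apply: eq_bigl => s; apply: andb_id2l => /eqP <-.
rewrite negb_exists; apply/forallP/forall_inP => sB k.
  rewrite !inE => /andP[/orP[/eqP ->|jk] prec]; first by rewrite /precedes ltnn in prec.
  by apply: contra (sB k) => sk; rewrite adj_sym jk sk.
apply/negP => /and3P[kj sk prec]; have := sB k.
by rewrite !inE adj_sym kj orbT prec sk => /(_ isT).
Qed.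

(** Additivity makes the value a combination of indicators of the events [j \in A w i]; nonnegative
    weights let the integral pass through the sum. *)
Lemma expectation_additive (N M : finType) (v : {set M} -> R)
    (A : T -> {ffun N -> {set M}}) (i : N) :
  additive_valuation v -> finite_rv A ->
  ('E_P[fun w => v (A w i)] =
   \sum_(j : M) (v [set j]%SET)%:E * P [set w | j \in A w i])%E.
Proof.
move=> [v0 vD] mA.
have mj j : measurable [set w | j \in A w i].
  exact: (measurable_finite_rv _ _ [pred a : {ffun N -> {set M}} | j \in a i] mA).
rewrite unlock.
transitivity (\int[P]_w \sum_(j : M)
    ((v [set j]%SET)%:E * (\1_[set w | j \in A w i] w)%:E))%E.
  apply: eq_integral => w _; rewrite vD -sumEFin big_mkcond; apply: eq_bigr => j _.
  rewrite indicE (_ : (w \in _) = (j \in A w i)); last first.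
    by apply/idP/idP; rewrite in_setE.
  by case: ifP; rewrite ?mule1 ?mule0.
rewrite ge0_integral_sum //; first last.
- by move=> j w _; rewrite mule_ge0 // lee_fin.
- move=> j; apply: measurable_funeM; apply/measurable_EFinP; exact: measurable_indic.
apply: eq_bigr => j _; rewrite ge0_integralZl_EFin //.
- by rewrite integral_indic // setIT.
- by apply/measurable_EFinP; exact: measurable_indic.
Qed.

End FiniteRandomVariables.

Theorem proposition7 (R : realType) (N M : finType)
    (v : N -> {set M} -> R) (adj : rel M)
    (hv : forall i : N, additive_valuation (v i))
    (hG : simple_graph adj)
    (hN : (max_degree adj < #|N|)%N)
    (d : measure_display) (T : measurableType d) (P : probability T R)
    (pi : T -> {perm M}) (t : T -> {ffun M -> N})
    (A : T -> {ffun N -> {set M}})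
    (hA : produced_by_procedure P adj pi t A) (i : N) :
  (((1 - (expR 1)^-1) * (v i [set: M]%SET / #|N|%:R))%:E
     <= 'E_P[fun w => v i (A w i)])%E.
Proof.
case: hA => upi ut ind mA cA; rewrite expectation_additive //.
have [v0 vD] := hv i.
rewrite vD mulr_suml mulr_sumr -sumEFin big_mkcond /=; apply: lee_sum => j _.
rewrite inE mulrCA EFinM; apply: lee_wpmul2l; first by rewrite lee_fin.
(* The last step of the procedure never moves an item that was kept, so being kept by [i] implies
   ending with [i], whatever the arbitrary choices. *)
apply: (@le_trans _ _
  (P [set w | (t w j == i) && ~~ deallocated adj (pi w) (t w) j]%classic)); last first.
  apply: le_measure.
  - have [mX _] := joint_law P _ _ _ _ upi ut ind; rewrite inE.
    exact: (measurable_finite_rv _ _ [pred x : {perm M} * {ffun M -> N} |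
      (x.2 j == i) && ~~ deallocated adj x.1 x.2 j] mX).
  - rewrite inE.
    exact: (measurable_finite_rv _ _ [pred a : {ffun N -> {set M}} | j \in a i] mA).
  - by move=> w /= /andP[/eqP <- kept]; exact: (cA w).2.
rewrite retention_probability // lee_fin mulrC ler_wpM2l ?invr_ge0 //.
apply: retention_bound; first by rewrite !inE eqxx.
(* As [j] is not its own neighbour, its closed neighbourhood has one item more than its degree; the
   strict bound [hN] absorbs that item. *)
rewrite cardsU1 !inE hG.2 add1n; apply: leq_ltn_trans hN.
by rewrite cardsE (leq_bigmax j).
Qed.
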